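(* Let $D \subseteq \{0,1\}^N$ and let $f : D \rightarrow \{0,1\}$ be a Boolean function. Then \[ \mathsf{PostR}_0(f) = \mathsf{N}(f) = \mathsf{C}(f). \]
   Context: A classical post-selected query algorithm $\mathcal{A}$ is a probability distribution over deterministic decision trees whose leaves are labelled $0$, $1$ or $\perp$; on input $x$ it picks a tree (independently of $x$) and outputs its output on $x$; its query complexity is the maximum depth of a tree in the support. $\mathsf{PostR}_0(f)$ is the minimum query complexity of such an algorithm with, for all $x\in D$, $\Pr[\mathcal{A}(x)\neq\perp]>0$ and $\Pr[\mathcal{A}(x)=f(x)\mid\mathcal{A}(x)\neq\perp]=1$. Certificate complexity: for $b\in\{0,1\}$, a $b$-certificate is a partial assignment $C : S\rightarrow\{0,1\}$, $S\subseteq[N]$, such that $f(y)=b$ for every $y\in D$ consistent with $C$; its size is $|S|$. For $x$ with $f(x)=b$, $\mathsf{C}^x(f)$ is the minimum size of a $b$-certificate consistent with $x$; $\mathsf{C}_1(f)=\max_{x:f(x)=1}\mathsf{C}^x(f)$, $\mathsf{C}_0(f)=\max_{x:f(x)=0}\mathsf{C}^x(f)$, and $\mathsf{C}(f)=\max\{\mathsf{C}_0(f),\mathsf{C}_1(f)\}$. Non-deterministic query complexity: $\mathsf{N}_b(f)$ is the minimum number of queries of a randomised classical query algorithm whose acceptance probability is positive on every $x$ with $f(x)=b$ and zero on every $x$ with $f(x)=1-b$; $\mathsf{N}(f)=\max\{\mathsf{N}_0(f),\mathsf{N}_1(f)\}$. *)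

(* Defs.v *)
(* Probabilities live in an arbitrary model [R : realType] of the real numbers. *)
From HB Require Import structures.
From mathcomp Require Import all_boot all_order all_algebra finmap.
From mathcomp Require Import boolp reals.

Set Implicit Arguments.
Unset Strict Implicit.
Unset Printing Implicit Defensive.

Import GRing.Theory Num.Theory.
Local Open Scope ring_scope.

Definition least (P : nat -> Prop) (exP : exists n, P n) : nat :=
  ex_minn (P := fun n => `[< P n >])
    (let: ex_intro n Pn := exP in ex_intro _ n (asboolT Pn)).

Lemma leastP (P : nat -> Prop) (exP : exists n, P n) :
  P (least exP) /\ forall m, P m -> (least exP <= m)%N.
Proof.
rewrite /least; case: ex_minnP => n /asboolP Pn min_n.
by split=> // m /asboolP; apply: min_n.
Qed.

Definition input (N : nat) := {ffun 'I_N -> bool}.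

(* The subtype of [D] is the domain of a partial Boolean function, so that no
   value is ever given to it outside of [D]. *)
Definition domain (N : nat) (D : {set input N}) := {x : input N | x \in D}.

(* [dnode i t0 t1] queries the bit [x_i] and continues with [t0] if it is 0,
   with [t1] if it is 1. *)
Inductive dtree (N : nat) (L : Type) : Type :=
| dleaf of L
| dnode of 'I_N & dtree N L & dtree N L.
Arguments dleaf {N L}.
Arguments dnode {N L}.

Fixpoint dtree_eval N L (t : dtree N L) (x : input N) : L :=
  match t with
  | dleaf l => l
  | dnode i t0 t1 => dtree_eval (if x i then t1 else t0) x
  end.

Fixpoint dtree_depth N L (t : dtree N L) : nat :=
  match t with
  | dleaf _ => 0
  | dnode _ t0 t1 => (maxn (dtree_depth t0) (dtree_depth t1)).+1
  end.

Section DtreeChoice.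
Variables (N : nat) (L : choiceType).

Fixpoint dtree_encode (t : dtree N L) : GenTree.tree ('I_N + L) :=
  match t with
  | dleaf l => GenTree.Leaf (inr l)
  | dnode i t0 t1 =>
      GenTree.Node 0 [:: GenTree.Leaf (inl i); dtree_encode t0; dtree_encode t1]
  end.

Fixpoint dtree_decode (t : GenTree.tree ('I_N + L)) : option (dtree N L) :=
  match t with
  | GenTree.Leaf (inr l) => Some (dleaf l)
  | GenTree.Node 0 [:: GenTree.Leaf (inl i); u0; u1] =>
      if (dtree_decode u0, dtree_decode u1) is (Some t0, Some t1)
      then Some (dnode i t0 t1) else None
  | _ => None
  end.

Lemma dtree_encodeK : pcancel dtree_encode dtree_decode.
Proof. by elim=> //= i t0 -> t1 ->. Qed.

HB.instance Definition _ := Choice.copy (dtree N L) (pcan_type dtree_encodeK).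

End DtreeChoice.

(* Finite support is no restriction here: for a fixed [N] there are finitely
   many trees of a given depth over a finite set of labels, and only algorithms
   whose trees have bounded depth have a (finite) query complexity. *)
Record distr (R : realType) (T : choiceType) := Distr {
  mass :> {fsfun T -> R with 0};
  mass_ge0 : forall t, 0 <= mass t;
  mass_sum1 : \sum_(t <- finsupp mass) mass t = 1
}.

Definition Pr (R : realType) (T : choiceType) (p : distr R T) (E : pred T) : R :=
  \sum_(t <- finsupp p | E t) p t.

Definition cPr (R : realType) (T : choiceType) (p : distr R T)
    (E F : pred T) : R :=
  Pr p (predI E F) / Pr p F.

Definition randalg (R : realType) (N : nat) (L : choiceType) :=
  distr R (dtree N L).

Definition query_complexity R N (L : choiceType) (A : randalg R N L) : nat :=
  (\max_(t <- finsupp A) dtree_depth t)%N.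

(* The event that the output of the algorithm on [x] satisfies [E]. *)
Definition outputs N L (x : input N) (E : pred L) : pred (dtree N L) :=
  fun t => E (dtree_eval t x).

(* The label [None] stands for the output "bottom". *)
Definition postselected_computes R N (D : {set input N}) (f : domain D -> bool)
    (A : randalg R N (option bool)) : Prop :=
  forall x : domain D,
    0 < Pr A (outputs (val x) (predC1 None)) /\
    cPr A (outputs (val x) (pred1 (Some (f x))))
          (outputs (val x) (predC1 None)) = 1.

(* Acceptance is the output [true]. *)
Definition nondet_computes R N (D : {set input N}) (f : domain D -> bool)
    (b : bool) (A : randalg R N bool) : Prop :=
  forall x : domain D,
    (f x = b -> 0 < Pr A (outputs (val x) (pred1 true))) /\
    (f x = ~~ b -> Pr A (outputs (val x) (pred1 true)) = 0).

Section Existence.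
Variables (R : realType) (N : nat).

Lemma dtree_exists L (g : input N -> L) :
  exists t : dtree N L, forall x, dtree_eval t x = g x.
Proof.
suff build (s : seq 'I_N) (y : 'I_N -> bool) : exists t : dtree N L, forall x,
    dtree_eval t x = g [ffun i => if i \in s then x i else y i].
  have [t Ht] := build (enum 'I_N) (fun=> false).
  exists t => x; rewrite Ht; congr g; apply/ffunP => i.
  by rewrite ffunE mem_enum.
elim: s y => [|j s IHs] y.
  exists (dleaf (g [ffun i => y i])) => x.
  by congr g; apply/ffunP => i; rewrite !ffunE.
have [t0 Ht0] := IHs (fun i => if i == j then false else y i).
have [t1 Ht1] := IHs (fun i => if i == j then true else y i).
exists (dnode j t0 t1) => x /=.
case xj: (x j); [rewrite Ht1 | rewrite Ht0]; congr g; apply/ffunP => i;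
  rewrite !ffunE inE; have [->|//] := eqVneq i j; by rewrite /= xj; case: ifP.
Qed.

Lemma finsupp_point (T : choiceType) (t0 : T) :
  finsupp [fsfun t in [fset t0]%fset => (1 : R) | 0] = [fset t0]%fset.
Proof.
apply/fsetP => t; rewrite mem_finsupp fsfunE inE.
by case: ifP; rewrite ?oner_eq0 ?eqxx.
Qed.

Fact point_ge0 (T : choiceType) (t0 t : T) :
  0 <= [fsfun t in [fset t0]%fset => (1 : R) | 0] t.
Proof. by rewrite fsfunE; case: ifP. Qed.

Fact point_sum1 (T : choiceType) (t0 : T) :
  \sum_(t <- finsupp [fsfun t in [fset t0]%fset => (1 : R) | 0])
     [fsfun t in [fset t0]%fset => (1 : R) | 0] t = 1.
Proof. by rewrite finsupp_point big_seq_fset1 fsfunE inE eqxx. Qed.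

Definition point (T : choiceType) (t0 : T) : distr R T :=
  Distr (point_ge0 t0) (point_sum1 t0).

Lemma Pr_point (T : choiceType) (t0 : T) (E : pred T) :
  Pr (point t0) E = (E t0)%:R.
Proof.
rewrite /Pr /= finsupp_point big_mkcond big_seq_fset1 fsfunE inE eqxx.
by case: (E t0).
Qed.

Variables (D : {set input N}) (f : domain D -> bool).

Let total (x : input N) : bool := if insub x is Some u then f u else false.

Let totalE (x : domain D) : total (val x) = f x.
Proof. by rewrite /total valK. Qed.

Lemma PostR0_exists : exists d : nat, exists A : randalg R N (option bool),
  postselected_computes f A /\ query_complexity A = d.
Proof.
have [t Ht] := dtree_exists (fun x => Some (total x)).
exists (query_complexity (point t)), (point t); split=> // x.
by rewrite /cPr !Pr_point /outputs /= Ht totalE eqxx /= ltr01 divr1.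
Qed.

Lemma N_exists (b : bool) : exists d : nat, exists A : randalg R N bool,
  nondet_computes f b A /\ query_complexity A = d.
Proof.
have [t Ht] := dtree_exists (fun x => total x == b).
exists (query_complexity (point t)), (point t); split=> // x.
rewrite !Pr_point /outputs /= Ht totalE; split=> -> //.
  by rewrite eqxx ltr01.
by case: b {Ht}.
Qed.

End Existence.

Definition PostR0 (R : realType) N (D : {set input N}) (f : domain D -> bool) :
    nat :=
  least (PostR0_exists R f).

Definition Nb (R : realType) N (D : {set input N}) (f : domain D -> bool)
    (b : bool) : nat :=
  least (N_exists R f b).

Definition Nc (R : realType) N (D : {set input N}) (f : domain D -> bool) :
    nat :=
  maxn (Nb R f false) (Nb R f true).

(* The indices mapped to [None] are those outside of the domain [S] of the
   partial assignment. *)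
Definition passign (N : nat) := {ffun 'I_N -> option bool}.

Definition passign_dom N (C : passign N) : {set 'I_N} := [set i | C i != None].

Definition consistent N (C : passign N) (x : input N) : Prop :=
  forall i, i \in passign_dom C -> C i = Some (x i).

Definition certificate N (D : {set input N}) (f : domain D -> bool) (b : bool)
    (C : passign N) : Prop :=
  forall y : domain D, consistent C (val y) -> f y = b.

Lemma Cx_exists N (D : {set input N}) (f : domain D -> bool) (x : domain D) :
  exists s : nat, exists C : passign N,
    [/\ certificate f (f x) C, consistent C (val x) & #|passign_dom C| = s].
Proof.
pose C : passign N := [ffun i => Some (val x i)].
exists #|passign_dom C|, C; split=> // [y Cy | i _]; last by rewrite ffunE.
congr f; apply/val_inj/ffunP => i.
by have := Cy i; rewrite inE ffunE => /(_ isT) [].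
Qed.

Definition Cx N (D : {set input N}) (f : domain D -> bool) (x : domain D) : nat :=
  least (Cx_exists f x).

Definition Cb N (D : {set input N}) (f : domain D -> bool) (b : bool) : nat :=
  (\max_(x : domain D | f x == b) Cx f x)%N.

Definition Cc N (D : {set input N}) (f : domain D -> bool) : nat :=
  maxn (Cb f false) (Cb f true).

(* Main.v *)
(* A tree that outputs a non-bottom label on x with positive probability must be
   right on every input of D following the same path, so the queried bits form a
   certificate for x.  Conversely, guessing at random a certificate of some input
   and outputting its label once it has been verified never errs, and succeeds on
   every x because the certificate of x itself may be guessed. *)
Require Import Defs.
From mathcomp Require Import all_boot reals.
From mathcomp Require Import all_order all_algebra finmap boolp.

Set Implicit Arguments.
Unset Strict Implicit.
Unset Printing Implicit Defensive.

Import Order.TTheory GRing.Theory Num.Theory.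

Lemma least_le (P : nat -> Prop) (exP : exists n, P n) m :
  P m -> least exP <= m.
Proof. exact: (leastP exP).2. Qed.

Lemma least_sat (P : nat -> Prop) (exP : exists n, P n) : P (least exP).
Proof. exact: (leastP exP).1. Qed.

Section Probability.
Local Open Scope ring_scope.
Variables (R : realType) (T : choiceType).
Implicit Types (p : distr R T) (E F : pred T).

Lemma Pr_ge0 p E : 0 <= Pr p E.
Proof. by apply: sumr_ge0 => t _; apply: mass_ge0. Qed.

Lemma Pr_eq0 p E : (Pr p E == 0) = ~~ has E (finsupp p).
Proof.
rewrite psumr_eq0; last by move=> t _; apply: mass_ge0.
rewrite -all_predC; apply: eq_in_all => t /=.
by rewrite mem_finsupp => /negbTE->; rewrite implybF.
Qed.

Lemma Pr_gt0 p E : (0 < Pr p E) = has E (finsupp p).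
Proof. by rewrite lt_def Pr_ge0 andbT Pr_eq0 negbK. Qed.

(** The event [F] splits along [E], so the quotient is 1 exactly when the part of [F] outside [E]
    has mass zero, that is, misses the support. *)
Lemma cPr_eq1 p E F : 0 < Pr p F ->
  (cPr p E F == 1) = all (fun t => F t ==> E t) (finsupp p).
Proof.
move=> F_gt0; rewrite /cPr.
have -> : Pr p F = Pr p (predI E F) + Pr p (predI (predC E) F).
  rewrite /Pr (bigID E) /=; congr (_ + _); apply: eq_bigl => t;
  by rewrite /= andbC.
have split_gt0 : 0 < Pr p (predI E F) + Pr p (predI (predC E) F).
  rewrite lt_def addr_ge0 ?Pr_ge0 // andbT paddr_eq0 ?Pr_ge0 // !Pr_eq0.
  rewrite -negb_or negbK -has_predU; move: F_gt0; rewrite Pr_gt0.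
  by apply: sub_has => t /= ->; rewrite !andbT orbN.
(* With 1 written as the denominator over itself, the difference is minus the mass of [F] outside
   [E], over a nonzero denominator. *)
rewrite -subr_eq0 -[X in _ - X](divff (lt0r_neq0 split_gt0)) -mulrBl.
rewrite mulf_eq0 invr_eq0 (negbTE (lt0r_neq0 split_gt0)) orbF.
rewrite opprD addNKr oppr_eq0 Pr_eq0 -all_predC; apply: eq_all => t /=.
by rewrite negb_and negbK orbC implybE.
Qed.

(** Positive, zero and conditionally certain events depend only on the support, so any weights would
    do; equal ones are the simplest. *)
Lemma uniform_exists (S : {fset T}) : S != fset0 ->
  exists p : distr R T, finsupp p = S.
Proof.
move=> S_neq0; pose u : R := #|` S|%:R^-1.
have u_neq0 : u != 0 by rewrite invr_eq0 pnatr_eq0 cardfs_eq0.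
pose m := [fsfun t in S => u | 0].
have supp_m : finsupp m = S.
  by apply/fsetP => t; rewrite mem_finsupp fsfunE; case: ifP; rewrite ?eqxx.
have m_ge0 t : 0 <= m t by rewrite fsfunE; case: ifP; rewrite // invr_ge0 ler0n.
have m_sum1 : \sum_(t <- finsupp m) m t = 1.
  rewrite supp_m big_seq (eq_bigr (fun=> u)) => [|t tS]; last by rewrite fsfunE tS.
  rewrite -big_seq big_const_seq count_predT iter_addr_0 -mulr_natl mulfV //.
  by rewrite -invr_eq0.
by exists (Distr m_ge0 m_sum1).
Qed.

End Probability.

Section DecisionTrees.
Variables (N : nat) (L : Type).

(** [S] collects the variables queried along the path of [x], at most one per level; agreeing with
    [x] there means following the same path. *)
Lemma dtree_eval_local (t : dtree N L) (x : input N) :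
  exists S : {set 'I_N}, #|S| <= dtree_depth t /\
    forall y : input N, {in S, y =1 x} -> dtree_eval t y = dtree_eval t x.
Proof.
elim: t => [l|i t0 [S0 [card0 eval0]] t1 [S1 [card1 eval1]]] /=.
  by exists set0; rewrite cards0.
exists (i |: if x i then S1 else S0); split=> [|y yx].
  rewrite (leq_trans (leq_card_setU _ _)) // cards1 add1n ltnS.
  by case: (x i); rewrite leq_max ?card0 ?card1 ?orbT.
rewrite yx ?setU11 //.
by case: (x i) yx => yx; [apply: eval1 | apply: eval0] => j jS;
  apply: yx; rewrite inE jS orbT.
Qed.

(** The tree queries the variables of [s] in order and exits with [b] at the first mismatch, so only
    one branch of each node continues. *)
Lemma dtree_check (C : passign N) (s : seq 'I_N) (a b : L) :
  exists t : dtree N L, dtree_depth t <= size s /\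
    forall x : input N,
      dtree_eval t x = if all (fun i => C i == Some (x i)) s then a else b.
Proof.
elim: s => [|i s [t [depth_t eval_t]]]; first by exists (dleaf a).
pose branch v := if C i == Some v then t else dleaf b.
exists (dnode i (branch false) (branch true)); split=> [|x] /=.
  have depth_branch v : dtree_depth (branch v) <= size s.
    by rewrite /branch; case: ifP.
  by rewrite ltnS geq_max !depth_branch.
by rewrite /branch; case: (x i); case: ifP => //= _; rewrite eval_t.
Qed.

End DecisionTrees.

Section Certificates.
Variables (N : nat) (D : {set input N}) (f : domain D -> bool).

Lemma Cx_le_depth L (t : dtree N L) (x : domain D) :
  (forall y : domain D,
     dtree_eval t (val y) = dtree_eval t (val x) -> f y = f x) ->
  Cx f x <= dtree_depth t.
Proof.
move=> correct; have [S [card_S local_S]] := dtree_eval_local t (val x).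
apply: leq_trans card_S; pose C : passign N :=
  [ffun i => if i \in S then Some (val x i) else None].
have domC : passign_dom C = S.
  by apply/setP => i; rewrite inE ffunE; case: (i \in S).
apply: least_le; exists C; split; last by rewrite domC.
- move=> y Cy; apply/correct/local_S => i iS.
  by have := Cy i; rewrite domC ffunE iS => /(_ isT) [].
- by move=> i; rewrite domC ffunE => ->.
Qed.

Lemma Cb_leP b d : reflect (forall x, f x = b -> Cx f x <= d) (Cb f b <= d).
Proof.
apply: (iffP (bigmax_leqP _ _ _)) => Cx_le x fx; apply: Cx_le; exact/eqP.
Qed.

Lemma Cx_le_Cb (x : domain D) : Cx f x <= Cb f (f x).
Proof. exact/(Cb_leP (f x) _ (leqnn _)). Qed.

(** [tc.2] is consistency with a smallest certificate of [x], and [tc.1] verifies it. Pairing the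
    two lets a single use of [choice] select both for all [x]. *)
Lemma Cx_tree L (x : domain D) (a b : L) :
  exists tc : dtree N L * pred (domain D),
  [/\ dtree_depth tc.1 <= Cx f x,
      tc.2 x,
      forall y, tc.2 y -> f y = f x &
      forall y, dtree_eval tc.1 (val y) = if tc.2 y then a else b].
Proof.
have [C [certC Cx_x cardC]] := least_sat (Cx_exists f x).
have [t [depth_t eval_t]] := dtree_check C (enum (passign_dom C)) a b.
pose c (y : domain D) :=
  all (fun i => C i == Some (val y i)) (enum (passign_dom C)).
exists (t, c); rewrite /c; split=> //=.
- by rewrite /Cx -cardC cardE.
- by apply/allP => i; rewrite mem_enum => /Cx_x/eqP.
- move=> y /allP Cy; apply: certC => i iC.
  by apply/eqP/Cy; rewrite mem_enum.
Qed.

(* The constant tree [dleaf b] only keeps the support nonempty. *)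
Lemma guess_certificate (R : realType) (L : choiceType) (P : pred (domain D))
    (a : domain D -> L) (b : L) d :
  (forall x, P x -> Cx f x <= d) ->
  exists A : randalg R N L,
  [/\ query_complexity A <= d,
      forall x, P x -> exists2 t, t \in finsupp A & dtree_eval t (val x) = a x &
      forall t y, t \in finsupp A -> dtree_eval t (val y) != b ->
        exists x, [/\ P x, f y = f x & dtree_eval t (val y) = a x]].
Proof.
move=> Cx_le; have [tc tcP] := choice (fun x => Cx_tree x (a x) b).
pose S := (dleaf b |` [fset (tc x).1 | x in P])%fset.
have [|A suppA] := @uniform_exists R _ S.
  by apply/fset0Pn; exists (dleaf b); rewrite fset1U1.
exists A; rewrite suppA; split.
- rewrite /query_complexity suppA; apply/bigmax_leqP_seq => t + _.
  move=> /fset1UP[->//|/imfsetP[x Px ->]].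
  by have [depth_x _ _ _] := tcP x; apply: leq_trans depth_x (Cx_le _ Px).
- move=> x Px; exists (tc x).1; first exact/fset1Ur/in_imfset.
  by have [_ cx _ ->] := tcP x; rewrite cx.
- move=> t y /fset1UP[->|/imfsetP[x Px ->]]; first by rewrite eqxx.
  (* An output other than [b] means that the certificate of [x] was verified on [y]. *)
  have [_ _ cf ->] := tcP x; case: ifP => [cy _|_]; last by rewrite eqxx.
  by exists x; split=> //; apply: cf.
Qed.

End Certificates.

Section QueryComplexity.
Variables (R : realType) (N : nat) (D : {set input N}) (f : domain D -> bool).

Lemma query_complexity_ge (L : choiceType) (A : randalg R N L) t :
  t \in finsupp A -> dtree_depth t <= query_complexity A.
Proof. by move=> tA; apply: leq_bigmax_seq. Qed.

Lemma Nb_Cb b : Nb R f b = Cb f b.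
Proof.
apply/eqP; rewrite eqn_leq; apply/andP; split.
  (* Only certificates of inputs with value [b] are guessed; a verified one accepts, and rejection
     is the default. *)
  have [x /eqP fx|A [cost hit sound]] :=
    @guess_certificate _ _ f R bool (fun x => f x == b) xpredT false (Cb f b).
    by rewrite -fx Cx_le_Cb.
  apply: leq_trans cost; apply: least_le; exists A; split=> // x.
  split=> fx.
    have [|t tA eval_t] := hit x; first exact/eqP.
    by rewrite Pr_gt0; apply/hasP; exists t; rewrite // /outputs /= eval_t.
  apply/eqP; rewrite Pr_eq0; apply/hasPn => t tA; rewrite /outputs /= eqb_id.
  apply/negP => eval_t; have [|z [/eqP fz fxz _]] := sound t x tA.
    by rewrite eval_t.
  by move: fx; rewrite fxz fz; case: (b).
rewrite /Nb; have [A [computes <-]] := least_sat (N_exists R f b).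
apply/Cb_leP => x fx; have [/(_ fx) + _] := computes x.
rewrite Pr_gt0 => /hasP[t tA /eqP eval_t].
apply: leq_trans (query_complexity_ge tA); apply: Cx_le_depth => y.
(* If [t] also accepted some [y] of the opposite value, then [y] would be accepted with positive
   probability. *)
rewrite eval_t => eval_y; rewrite fx; apply/eqP/negPn/negP => fy.
have fy_neg : f y = ~~ b by move: fy; case: (f y); case: (b).
have [_ /(_ fy_neg)/eqP] := computes y; rewrite Pr_eq0 => /hasPn/(_ _ tA).
by rewrite /outputs /= eval_y.
Qed.

(** Here certificates of both values are guessed, each labelled with its value, and bottom is the
    default; hence the maximum over both values. *)
Lemma PostR0_Cc : PostR0 R f = Cc f.
Proof.
have CxC x : Cx f x <= Cc f.
  by apply: leq_trans (Cx_le_Cb f x) _; rewrite leq_max;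
    case: (f x); rewrite leqnn ?orbT.
apply/eqP; rewrite eqn_leq; apply/andP; split.
  have [//|A [cost hit sound]] :=
    @guess_certificate _ _ f R (option bool) xpredT (Some \o f) None (Cc f).
  apply: leq_trans cost; apply: least_le; exists A; split=> // x.
  have [//|t tA eval_t] := hit x.
  have Pr_pos : (0 < Pr A (outputs (val x) (predC1 None)))%R.
    by rewrite Pr_gt0; apply/hasP; exists t; rewrite // /outputs /= eval_t.
  split=> //; apply/eqP; rewrite cPr_eq1 //; apply/allP => u uA.
  by apply/implyP => /(sound _ _ uA)[z [_ -> eval_u]]; rewrite /outputs /= eval_u.
rewrite /PostR0; have [A [computes <-]] := least_sat (PostR0_exists R f).
suff Cx_le x : Cx f x <= query_complexity A.
  by rewrite geq_max; apply/andP; split; apply/Cb_leP.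
(* Conditional probability 1 makes each single tree of the support correct wherever it does not
   output bottom. *)
have sound y t : t \in finsupp A -> dtree_eval t (val y) != None ->
    dtree_eval t (val y) = Some (f y).
  have [Pr_pos /eqP] := computes y; rewrite cPr_eq1 // => /allP out tA some.
  by apply/eqP; have := out t tA => /implyP; apply.
have [+ _] := computes x; rewrite Pr_gt0 => /hasP[t tA some_x].
apply: leq_trans (query_complexity_ge tA); apply: Cx_le_depth => y eval_y.
have := sound y t tA; rewrite eval_y => /(_ some_x).
by rewrite (sound x t tA some_x) => -[].
Qed.

End QueryComplexity.

Theorem theorem2 (R : realType) (N : nat) (D : {set input N})
    (f : domain D -> bool) :
  PostR0 R f = Nc R f /\ Nc R f = Cc f.
Proof. by rewrite PostR0_Cc /Nc !Nb_Cb. Qed.
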